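(* Let $\Lambda$ be a real random variable whose moments $m_n=\mathbb{E}[\Lambda^n]$ exist for all orders $n\ge 1$, and let $(\kappa_n)_{n\ge1}$ be the free cumulants of $\Lambda$. Define a sequence of random variables $(Q_n)_{n\ge0}$ recursively by $Q_0:=1$ and $$Q_n=\Lambda Q_{n-1}-\sum_{i=1}^n \mathbb{E}[\Lambda Q_{i-1}]\cdot Q_{n-i},\qquad \forall n\ge1 .$$ Then $$\mathbb{E}[\Lambda Q_{n-1}]=\kappa_n,\qquad\forall n\ge1 .$$
   Context: A partition of $[k]=\{1,\dots,k\}$ into nonempty disjoint blocks is non-crossing if there are no $1\le a<b<c<d\le k$ such that $a,c$ belong to one block and $b,d$ belong to another (different) block. $\mathrm{NC}(k)$ is the set of non-crossing partitions of $[k]$. The free cumulants $(\kappa_k)_{k\ge1}$ of $\Lambda$ are the unique real sequence determined by the moment-cumulant formula $m_k=\sum_{\pi\in \mathrm{NC}(k)}\prod_{B\in\pi}\kappa_{|B|}$ for all $k\ge1$, where the product runs over the blocks $B$ of $\pi$ and $|B|$ is the cardinality of $B$. *)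

(* Defs.v *)
From HB Require Import structures.
From mathcomp Require Export all_boot all_order all_algebra.
From mathcomp Require Export all_classical all_reals all_analysis.

Set Implicit Arguments.
Unset Strict Implicit.
Unset Printing Implicit Defensive.

Import Order.TTheory GRing.Theory Num.Theory.
Local Open Scope ring_scope.

(* [k] = {1, ..., k} is represented by 'I_k = {0, ..., k - 1}; the shift
   preserves the order, hence the notion of crossing. *)
Definition noncrossing (k : nat) (pi : {set {set 'I_k}}) : bool :=
  ~~ [exists B in pi, exists C in pi, (B != C) &&
       [exists a in B, exists c in B, exists b in C, exists d in C,
          [&& (a < b)%N, (b < c)%N & (c < d)%N]]].

Definition NC (k : nat) : {set {set {set 'I_k}}} :=
  [set pi | finset.partition pi [set: 'I_k] & noncrossing pi].

(* The moment-cumulant relations determine kappa n for all n >= 1; kappa 0 does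
   not occur in them, since the blocks of a partition are nonempty. *)
Definition is_free_cumulants d (T : measurableType d) (R : realType)
    (P : probability T R) (X : {RV P >-> R}) (kappa : nat -> R) : Prop :=
  forall k : nat, (1 <= k)%N ->
    ('E_P[(fun w => X w ^+ k)%R])%E =
      (\sum_(pi in NC k) \prod_(B in pi) kappa #|B|)%:E.

(* The expectations are extended reals, turned into real coefficients by fine.
   When all moments of X are finite, each Q n is a polynomial in X, so that
   these expectations are finite and fine discards nothing. *)
Definition is_Q_sequence d (T : measurableType d) (R : realType)
    (P : probability T R) (X : {RV P >-> R}) (Q : nat -> {RV P >-> R}) : Prop :=
  (forall w, Q 0%N w = 1) /\
  (forall n : nat, (1 <= n)%N -> forall w,
     Q n w = X w * Q n.-1 w
       - \sum_(1 <= i < n.+1)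
           fine ('E_P[(fun w' => X w' * Q i.-1 w')%R])%E * Q (n - i)%N w).

(* Main.v *)
(* Put c_n = E[Lambda Q_(n-1)].  The recursion reads
     Lambda Q_n = Q_(n+1) + sum_(j <= n) c_(n+1-j) Q_j,
   and taking expectations gives E[Q_n] = 0 for n >= 1 by induction.
   Iterating it expands Lambda^k as a sum over pairs (S, pi), where S is a set
   of "open" elements of [k] and pi is a non-crossing partition of the remaining
   ones, no block of which surrounds an element of S; the pair contributes
   (prod_(B in pi) c_|B|) Q_|S|.  Indeed, multiplying by Lambda adds a new
   largest element z, which either stays open (the term Q_(n+1)), or closes a
   block formed by z and the last |S| - j elements of S (the term Q_j).
   In expectation only the pairs with S empty survive, so that (c_n) satisfies
   the moment-cumulant relations, which determine it. *)
Require Import Defs.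

Set Implicit Arguments.
Unset Strict Implicit.
Unset Printing Implicit Defensive.

Import Order.TTheory GRing.Theory Num.Theory.
Local Open Scope ring_scope.

(** * Partitions with open elements, and initial segments *)

Definition below (N k : nat) : {set 'I_N} := [set x : 'I_N | (x < k)%N].

Definition uncovered (N : nat) (S : {set 'I_N}) (pi : {set {set 'I_N}}) : bool :=
  [forall B in pi, forall a in B, forall c in B, forall s in S,
     ~~ ((a < s) && (s < c))%N].

(* Keeping the ground type 'I_N fixed while k varies avoids transporting set
   partitions between ordinal types. *)
Definition open_nc (N k : nat) (S : {set 'I_N}) (pi : {set {set 'I_N}}) : bool :=
  [&& S \subset below N k, finset.partition pi (below N k :\: S),
      noncrossing pi & uncovered S pi].

(** These are the sets U that may stay open when a new largest element closes a block with S \ U: an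
    element of S \ U lying below some u in U would let that block surround u. *)
Definition initials (N : nat) (S : {set 'I_N}) : {set {set 'I_N}} :=
  [set U : {set 'I_N} | (U \subset S) &&
     [forall u in U, forall s in S :\: U, (u < s)%N]].

Lemma noncrossingP (N : nat) (pi : {set {set 'I_N}}) :
  reflect (forall B C a b c d, B \in pi -> C \in pi ->
             a \in B -> c \in B -> b \in C -> d \in C ->
             (a < b)%N -> (b < c)%N -> (c < d)%N -> B = C)
          (noncrossing pi).
Proof.
apply: (iffP idP) => [nc B C a b c d Bpi Cpi aB cB bC dC ab bc cd|nc].
  apply/eqP; apply: contraNT nc => neBC.
  apply/existsP; exists B; rewrite Bpi /=.
  apply/existsP; exists C; rewrite Cpi neBC /=.
  apply/existsP; exists a; rewrite aB /=.
  apply/existsP; exists c; rewrite cB /=.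
  apply/existsP; exists b; rewrite bC /=.
  by apply/existsP; exists d; rewrite dC ab bc cd.
apply/negP => /existsP[B /andP[Bpi /existsP[C /and3P[Cpi /eqP neBC]]]].
move=> /existsP[a /andP[aB /existsP[c /andP[cB /existsP[b /andP[bC]]]]]].
move=> /existsP[d /and4P[dC ab bc cd]].
by apply: neBC; apply: (nc B C a b c d).
Qed.

Lemma uncoveredP (N : nat) (S : {set 'I_N}) (pi : {set {set 'I_N}}) :
  reflect (forall B a c s, B \in pi -> a \in B -> c \in B -> s \in S ->
             (a < s)%N -> (s < c)%N -> False)
          (uncovered S pi).
Proof.
apply: (iffP idP) => [uc B a c s Bpi aB cB sS as_ sc|uc].
  move/forall_inP/(_ B Bpi)/forall_inP/(_ a aB)/forall_inP/(_ c cB): uc.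
  by move=> /forall_inP/(_ s sS); rewrite as_ sc.
apply/forall_inP => B Bpi; apply/forall_inP => a aB; apply/forall_inP => c cB.
by apply/forall_inP => s sS; apply/negP => /andP[]; apply: (uc B a c s).
Qed.

Lemma initialsP (N : nat) (S U : {set 'I_N}) :
  reflect (U \subset S /\
           forall u s, u \in U -> s \in S -> s \notin U -> (u < s)%N)
          (U \in initials S).
Proof.
rewrite inE; apply: (iffP andP) => -[US lt_US]; split=> //.
  move=> u s uU sS sU; move/forall_inP/(_ u uU)/forall_inP: lt_US; apply.
  by rewrite finset.in_setD sU.
apply/forall_inP => u uU; apply/forall_inP => s.
by rewrite finset.in_setD => /andP[sU sS]; apply: lt_US.
Qed.

(** There is exactly one initial segment of each size from 0 to |S|. By induction on |S|: if m is
    the largest element of S, an initial segment containing m is all of S, and the others are the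
    initial segments of S \ m. *)
Lemma sum_initials (N : nat) (V : nmodType) (f : nat -> V) (S : {set 'I_N}) :
  \sum_(U in initials S) f #|U| = \sum_(j < #|S|.+1) f j.
Proof.
move: {2}#|S| (erefl #|S|) => n; elim: n S => [|n IHn] S Sn.
  move/eqP: Sn; rewrite cards_eq0 => /eqP ->.
  rewrite cards0 big_ord1 (_ : initials _ = [set finset.set0]) ?big_set1 ?cards0 //.
  apply/setP => U; rewrite finset.in_set1; apply/initialsP/eqP => [[]|->].
    by rewrite finset.subset0 => /eqP.
  by split=> // u s; rewrite finset.in_set0.
have /card_gt0P[i0 i0S] : (0 < #|S|)%N by rewrite Sn.
case: (@arg_maxnP _ i0 (mem S) val i0S) => m mS maxm.
have {}mS : m \in S by [].
have cardS : #|S| = #|S :\ m|.+1 by rewrite (cardsD1 m) mS.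
have -> : initials S = S |: initials (S :\ m).
  apply/setP => U; rewrite finset.in_setU1.
  apply/initialsP/orP => [[US ltU]|[/eqP->|/initialsP[US ltU]]].
  - have [->|neUS] := eqVneq U S; [by left|right].
    have /fintype.subsetPn[t tS tU] : ~~ (S \subset U).
      by apply: contraNN neUS; rewrite finset.eqEsubset US.
    have mU : m \notin U.
      apply/negP => mU; have := ltU m t mU tS tU; rewrite ltnNge.
      by have /= -> := maxm t tS.
    apply/initialsP; split; first by rewrite finset.subsetD1 US.
    by move=> u s uU /setD1P[_ sS]; apply: ltU.
  - by split=> // u s _ sS; rewrite sS.
  - split; first by apply: (fintype.subset_trans US); rewrite finset.subD1set.
    move=> u s uU sS sU; have /setD1P[neum uS] := fintype.subsetP US u uU.
    have [->|nesm] := eqVneq s m.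
      by rewrite ltn_neqAle (inj_eq val_inj) neum; apply: maxm.
    by apply: ltU => //; rewrite finset.in_setD1 nesm.
rewrite big_setU1 /=; last first.
  apply/negP => /initialsP[/fintype.subsetP/(_ m mS)].
  by rewrite finset.setD11.
rewrite IHn; last by move: cardS; rewrite Sn => -[].
by rewrite [in RHS]big_ord_recr /= addrC cardS.
Qed.

(** * Adding a largest element, and the expansion of powers *)

Lemma belowS (N k : nat) (z : 'I_N) : z = k :> nat ->
  below N k.+1 = z |: below N k.
Proof.
move=> zk; apply/setP => x.
by rewrite finset.in_setU1 !inE ltnS leq_eqVlt -zk (inj_eq val_inj).
Qed.

Lemma notin_below (N k : nat) (z : 'I_N) : z = k :> nat -> z \notin below N k.
Proof. by move=> zk; rewrite inE zk ltnn. Qed.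

(** All blocks of [pi] lie below [z], so none of them can surround [z]; opening it adds no
    constraint. *)
Lemma open_nc_add_open (N k : nat) (z : 'I_N) (S : {set 'I_N}) pi :
  z = k :> nat -> z \notin S ->
  open_nc k.+1 (z |: S) pi = open_nc k S pi.
Proof.
move=> zk zS; have zb := notin_below zk.
rewrite /open_nc (belowS zk).
have -> : (z |: below N k) :\: (z |: S) = below N k :\: S.
  apply/setP => x; rewrite !finset.in_setD !finset.in_setU1.
  by case: eqVneq => [->|//]; rewrite (negbTE zb) andbF.
have -> : (z |: S \subset z |: below N k) = (S \subset below N k).
  apply/idP/idP => [/fintype.subsetP sub|]; last exact: finset.setUS.
  apply/fintype.subsetP => x xS; have := sub x; rewrite !finset.in_setU1 xS orbT.
  move=> /(_ isT).
  by case: eqVneq => [xz|_ /= ->//]; rewrite -xz xS in zS.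
case: (S \subset _) => //=; case: (boolP (finset.partition _ _)) => //= pP.
congr (_ && _); apply/uncoveredP/uncoveredP => uc B a c s Bpi aB cB sS.
  by apply: (uc B a c s) => //; rewrite finset.in_setU1 sS orbT.
move: sS; rewrite finset.in_setU1 => /orP[/eqP->|sS]; last exact: (uc B a c s).
move=> _; have := fintype.subsetP (partitionS pP Bpi) c cB.
by rewrite finset.in_setD !inE zk => /andP[_ ck]; rewrite ltnNge ltnW.
Qed.

(** A crossing between the new block and an old block C would put an element of the new block other
    than [z] between two elements of C. That element was open in S, which [uncovered] forbids. *)
Lemma open_nc_close (N k : nat) (z : 'I_N) (S U : {set 'I_N}) pi :
  z = k :> nat -> open_nc k S pi -> U \in initials S ->
  open_nc k.+1 U ((z |: S :\: U) |: pi).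
Proof.
move=> zk /and4P[Sb pP /noncrossingP nc /uncoveredP uc] /initialsP[US ltU].
have zb := notin_below zk.
have zS : z \notin S by apply: contraNN zb; apply: (fintype.subsetP Sb).
have zU : z \notin U by apply: contraNN zS; apply: (fintype.subsetP US).
have ltz C x : C \in pi -> x \in C -> (x < z)%N.
  move=> Cpi xC; have := fintype.subsetP (partitionS pP Cpi) x xC.
  by rewrite finset.in_setD !inE zk => /andP[].
have memB x : x \in z |: S :\: U -> (x < z)%N -> x \in S /\ x \notin U.
  rewrite finset.in_setU1 finset.in_setD => /orP[/eqP->|/andP[]//].
  by rewrite ltnn.
apply/and4P; split.
- by rewrite (belowS zk); apply: fintype.subset_trans US _;
  apply: fintype.subset_trans Sb _; apply: finset.subsetUr.
- have -> : below N k.+1 :\: U = (z |: S :\: U) :|: (below N k :\: S).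
    rewrite (belowS zk); apply/setP => x.
    rewrite !(finset.in_setD, finset.in_setU, finset.in_set1).
    case: eqVneq => [->|nexz] /=; first by rewrite zU.
    case: (boolP (x \in S)) => xS /=.
      by rewrite (fintype.subsetP Sb x xS) orbF.
    rewrite andbF /=; case: (boolP (x \in U)) => //.
    by move=> /(fintype.subsetP US); rewrite (negbTE xS).
  apply: partitionU1 => //.
    by apply/finset.set0Pn; exists z; rewrite finset.setU11.
  rewrite disjoint_subset; apply/fintype.subsetP => x.
  rewrite !inE; case: eqVneq => [->|_] /=; first by rewrite zk ltnn andbF.
  by move=> /andP[_ ->].
- apply/noncrossingP => B C a b c d.
  rewrite !finset.in_setU1 => /orP[/eqP->|Bpi] /orP[/eqP->|Cpi] //;
    move=> aB cB bC dC ab bc cd.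
  + have [cS _] := memB c cB (ltn_trans cd (ltz C d Cpi dC)).
    by case: (uc C b d c Cpi bC dC cS bc cd).
  + have [bS _] := memB b bC (ltn_trans bc (ltz B c Bpi cB)).
    by case: (uc B a c b Bpi aB cB bS ab bc).
  + exact: (nc B C a b c d).
- apply/uncoveredP => B a c s; rewrite finset.in_setU1 => /orP[/eqP->|Bpi];
    move=> aB cB sU as_ sc.
    have sz : (s < z)%N
      by have := fintype.subsetP Sb _ (fintype.subsetP US s sU); rewrite inE zk.
    have [aS aU] := memB a aB (ltn_trans as_ sz).
    by have := ltU s a sU aS aU; rewrite ltnNge ltnW.
  by apply: (uc B a c s) => //; apply: (fintype.subsetP US).
Qed.

(** Inverse of [open_nc_close]: the block of the largest element is dissolved into open elements. U
    is initial in the result because an element of [B :\ z] below some u in U would, together with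
    [z], make B surround u. *)
Lemma open_nc_unclose (N k : nat) (z : 'I_N) (U B : {set 'I_N}) pi :
  z = k :> nat -> open_nc k.+1 U pi -> B \in pi -> z \in B ->
  open_nc k (U :|: B :\ z) (pi :\ B) /\ U \in initials (U :|: B :\ z).
Proof.
move=> zk /and4P[Ub pP /noncrossingP nc /uncoveredP uc] Bpi zB.
have zb := notin_below zk.
have subB := fintype.subsetP (partitionS pP Bpi).
have zU : z \notin U by have := subB z zB; rewrite finset.in_setD => /andP[].
have BU x : x \in B -> x \notin U.
  by move/subB; rewrite finset.in_setD => /andP[].
have ltBz x : x \in B -> x != z -> (x < z)%N.
  move/subB; rewrite finset.in_setD (belowS zk) finset.in_setU1.
  by case: eqVneq => //= _ /andP[_]; rewrite inE zk.
have ltUz u : u \in U -> (u < z)%N.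
  move=> uU; have := fintype.subsetP Ub u uU; rewrite (belowS zk) finset.in_setU1.
  case: eqVneq => [uz|_]; first by rewrite -uz uU in zU.
  by rewrite inE zk.
split; last first.
  apply/initialsP; split; first exact: finset.subsetUl.
  move=> u s uU; rewrite finset.in_setU finset.in_setD1.
  move=> /orP[->//|/andP[nesz sB]] sU.
  rewrite ltnNge leq_eqVlt (inj_eq val_inj); apply/negP => /orP[/eqP su|su].
    by rewrite su uU in sU.
  exact: (uc B s z u Bpi sB zB uU su (ltUz u uU)).
apply/and4P; split.
- apply/fintype.subsetP => x; rewrite finset.in_setU finset.in_setD1 inE -zk.
  by move=> /orP[/ltUz//|/andP[nexz xB]]; apply: ltBz.
- have -> : below N k :\: (U :|: B :\ z) = (below N k.+1 :\: U) :\: B.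
    rewrite (belowS zk); apply/setP => x.
    rewrite !(finset.in_setD, finset.in_setU, finset.in_set1).
    case: eqVneq => [->|nexz] /=; first by rewrite (negbTE zb) zB andbF.
    by rewrite negb_or -andbA andbCA.
  exact: partitionD1.
- apply/noncrossingP => C D a b c d /setD1P[_ Cpi] /setD1P[_ Dpi].
  exact: nc.
- apply/uncoveredP => C a c s /setD1P[neCB Cpi] aC cC.
  rewrite finset.in_setU finset.in_setD1 => /orP[sU|/andP[nesz sB]] as_ sc.
    exact: (uc C a c s).
  (* Here c differs from [z], whose block is B. Then a < s < c < z would be a crossing of C and
     B. *)
  have cz : (c < z)%N.
    have := fintype.subsetP (partitionS pP Cpi) c cC.
    rewrite finset.in_setD (belowS zk) finset.in_setU1.
    case: eqVneq => [cz _|_ /andP[_]]; last by rewrite inE zk.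
    case/eqP: neCB; rewrite cz in cC.
    by rewrite -(def_pblock (partition_trivIset pP) Cpi cC)
               (def_pblock (partition_trivIset pP) Bpi zB).
  by case/eqP: neCB; apply: (nc C B a s c z).
Qed.

(** The configurations on k + 1 elements are split according to whether [z] is open. Each half is
    reindexed by an explicit bijection. *)
Lemma sum_open_nc_succ (N k : nat) (z : 'I_N) (V : nmodType)
    (F : {set 'I_N} -> {set {set 'I_N}} -> V) :
  z = k :> nat ->
  \sum_(p : {set 'I_N} * {set {set 'I_N}} | open_nc k.+1 p.1 p.2) F p.1 p.2 =
  \sum_(p : {set 'I_N} * {set {set 'I_N}} | open_nc k p.1 p.2)
    (F (z |: p.1) p.2 +
     \sum_(U in initials p.1) F U ((z |: p.1 :\: U) |: p.2)).
Proof.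
move=> zk; have zb := notin_below zk.
rewrite (bigID (fun p : {set 'I_N} * {set {set 'I_N}} => z \in p.1)) big_split /=.
congr (_ + _).
  pose h (p : {set 'I_N} * {set {set 'I_N}}) := (z |: p.1, p.2).
  pose h' (p : {set 'I_N} * {set {set 'I_N}}) := (p.1 :\ z, p.2).
  rewrite (reindex_onto h h') => [|[S pi] /= /andP[_ zS]]; last first.
    by rewrite /h /= finset.setD1K.
  apply: eq_bigl => -[S pi]; rewrite /h /h' /= finset.setU11 andbT.
  (* If [z] is in S, both conditions fail: S is not contained in [below N k], and adding then
     removing [z] does not give S back. *)
  case: (boolP (z \in S)) => zS.
    rewrite [RHS](_ : _ = false); last first.
      by apply: contraNF zb => /and4P[/fintype.subsetP/(_ z zS)].
    apply/negbTE; rewrite negb_and; apply/orP; right.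
    by apply: contraTneq zS => -[<-]; rewrite finset.setD11.
  by rewrite (open_nc_add_open _ zk zS) setU1K // eqxx andbT.
rewrite pair_big_dep /=.
(* Triples ((S, pi), U) correspond to configurations in which [z] is not open; the inverse recovers
   S and [pi] from the block of [z]. *)
pose T := {set 'I_N}; pose h (t : T * {set T} * T) :=
  (t.2, (z |: t.1.1 :\: t.2) |: t.1.2).
pose h' (p : T * {set T}) :=
  (p.1 :|: finset.pblock p.2 z :\ z, p.2 :\ finset.pblock p.2 z, p.1).
have pblockz U pi : open_nc k.+1 U pi -> z \notin U ->
    finset.pblock pi z \in pi /\ z \in finset.pblock pi z.
  case/and4P=> _ pP _ _ zU.
  rewrite pblock_mem ?mem_pblock (cover_partition pP) finset.in_setD zU.
    by rewrite (belowS zk) finset.setU11.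
  by rewrite (belowS zk) finset.setU11.
rewrite (reindex_onto h h') => [|[U pi] /= /andP[onc zU]]; last first.
  have [Bpi zB] := pblockz U pi onc zU; rewrite /h /=; congr (_, _).
  have BU : [disjoint finset.pblock pi z & U].
    case/and4P: onc => _ pP _ _; have := partitionS pP Bpi.
    by rewrite finset.subsetD => /andP[].
  rewrite finset.setDUl finset.setDv finset.set0U.
  have -> : finset.pblock pi z :\ z :\: U = finset.pblock pi z :\ z.
    apply/finset.setDidPl; apply: disjointWl BU; exact: finset.subD1set.
  by rewrite !finset.setD1K.
apply: eq_bigl => -[[S pi] U]; rewrite /h /h' /=.
apply/andP/andP => [[/andP[onc zU] /eqP e]|[onc US]].
  have zB : z \in z |: S :\: U by rewrite finset.setU11.
  have [] := open_nc_unclose zk onc (finset.setU11 _ _) zB.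
  case/and4P: onc => _ pP _ _.
  rewrite (def_pblock (partition_trivIset pP) (finset.setU11 _ _) zB) in e.
  by case: e => -> ->.
have onc' := open_nc_close zk onc US.
case/and4P: onc => Sb pP _ _; case/initialsP: US => US _.
have zS : z \notin S by apply: contraNN zb; apply: (fintype.subsetP Sb).
have zU : z \notin U by apply: contraNN zS; apply: (fintype.subsetP US).
split; first by rewrite onc'.
have zB : z \in z |: S :\: U by rewrite finset.setU11.
case/and4P: onc' => _ pP' _ _.
rewrite (def_pblock (partition_trivIset pP') (finset.setU11 _ _) zB).
rewrite !setU1K ?finset.in_setD ?(negbTE zS) ?andbF //.
  by rewrite -[X in X :|: _](finset.setIidPr US) finset.setID.
apply/negP => /(partitionS pP)/fintype.subsetP/(_ z zB).
by rewrite finset.in_setD (negbTE zb) andbF.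
Qed.

(** A purely algebraic identity, meant to be applied at each outcome w with [x] the value of the
    random variable and [q n] that of [Q n]. The induction on k multiplies by [x] and matches the
    recursion with [sum_open_nc_succ]. *)
Lemma expr_open_nc (R : comNzRingType) (x : R) (c q : nat -> R) (N k : nat) :
  q 0%N = 1 ->
  (forall n, x * q n = q n.+1 + \sum_(j < n.+1) c (n.+1 - j)%N * q j) ->
  (k <= N)%N ->
  x ^+ k = \sum_(p : {set 'I_N} * {set {set 'I_N}} | open_nc k p.1 p.2)
             (\prod_(B in p.2) c #|B|) * q #|p.1|.
Proof.
move=> q0 qS; elim: k => [_|k IHk ltkN].
  rewrite (big_pred1 (finset.set0, finset.set0)) => [|[S pi]] /=.
    by rewrite big_set0 cards0 q0 mulr1.
  have b0 : below N 0 = finset.set0 by apply/setP => x0; rewrite !inE.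
  rewrite /open_nc b0 finset.subset0 finset.set0D partition_set0 xpair_eqE.
  case: eqP => //= _; case: eqP => //= ->.
  apply/andP; split.
    by apply/noncrossingP => B C a b c' d; rewrite finset.in_set0.
  by apply/uncoveredP => B a c' s; rewrite finset.in_set0.
pose z : 'I_N := Ordinal ltkN.
rewrite (sum_open_nc_succ (z := z)
  (fun S pi => (\prod_(B in pi) c #|B|) * q #|S|)) //.
rewrite exprS (IHk (ltnW ltkN)) big_distrr /=; apply: eq_bigr => -[S pi] /= onc.
have zb : z \notin below N k by apply: notin_below.
case/and4P: onc => Sb pP _ _.
have zS : z \notin S by apply: contraNN zb; apply: (fintype.subsetP Sb).
rewrite mulrCA qS mulrDr cardsU1 zS add1n; congr (_ + _).
(* The sum over j becomes a sum over the initial segments U of S, with j = |U|. *)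
rewrite -(sum_initials (fun j => c (#|S|.+1 - j)%N * q j)) mulr_sumr.
apply: eq_bigr => U /initialsP[US _].
rewrite big_setU1 /=; last first.
  apply/negP => /(partitionS pP)/fintype.subsetP/(_ z).
  by rewrite finset.setU11 finset.in_setD (negbTE zb) andbF => /(_ isT).
(* The closed block has |S| + 1 - |U| elements, which is the index of [c] in the recursion. *)
rewrite cardsU1 finset.in_setD (negbTE zS) andbF /= add1n cardsD (finset.setIidPr US).
by rewrite subSn ?subset_leq_card // mulrA [c _ * _]mulrC.
Qed.

(** * Moment-cumulant relations and uniqueness *)

Lemma open_nc0 (k : nat) (pi : {set {set 'I_k}}) :
  open_nc k finset.set0 pi = (pi \in NC k).
Proof.
have bT : below k k = [set: 'I_k] by apply/setP => x; rewrite !inE ltn_ord.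
rewrite /open_nc finset.sub0set finset.setD0 bT [in RHS]inE /= andbA.
rewrite andb_idr // => _; apply/uncoveredP => B a c s _ _ _.
by rewrite finset.in_set0.
Qed.

(** Strong induction on n: the one-block partition contributes the n-th coefficient alone, while
    every other partition has only blocks of size less than n, where the two sequences already
    agree. *)
Lemma sum_NC_inj (R : comNzRingType) (c c' : nat -> R) :
  (forall k, (1 <= k)%N ->
     \sum_(pi in NC k) \prod_(B in pi) c #|B| =
     \sum_(pi in NC k) \prod_(B in pi) c' #|B|) ->
  forall n, (1 <= n)%N -> c n = c' n.
Proof.
move=> eqNC n; elim/ltn_ind: n => n IHn n_gt0.
have setT_NC : [set [set: 'I_n]] \in NC n.
  rewrite inE; apply/andP; split.
    rewrite /finset.partition /finset.trivIset /finset.cover !big_set1 !eqxx /=.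
    rewrite finset.in_set1 finset.eqEsubset finset.sub0set finset.subset0.
    by rewrite -cards_eq0 cardsT card_ord -lt0n.
  by apply/noncrossingP => B C a b c0 d /finset.set1P-> /finset.set1P->.
have := eqNC n n_gt0; rewrite !(bigD1 _ setT_NC) /= !big_set1 cardsT card_ord.
suff -> : \sum_(pi in NC n | pi != [set [set: 'I_n]]) \prod_(B in pi) c #|B| =
   \sum_(pi in NC n | pi != [set [set: 'I_n]]) \prod_(B in pi) c' #|B|.
  exact: addIr.
apply: eq_bigr => pi /andP[]; rewrite inE => /andP[pP _] neT.
apply: eq_bigr => B Bpi; apply: IHn; last first.
  by rewrite card_gt0 (partition_neq0 pP Bpi).
have := max_card (mem B); rewrite card_ord ltn_neqAle => -> ; rewrite andbT.
(* A block of size n is the whole set; removing it leaves a partition of the empty set, so [pi] has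
   just that block. *)
apply: contraNneq neT => cardB.
have BT : B = [set: 'I_n].
  by apply/eqP; rewrite finset.eqEcard finset.subsetT cardsT card_ord cardB /=.
have := partitionD1 pP Bpi; rewrite BT finset.setDv partition_set0.
by rewrite -(finset.setD1K Bpi) BT setU1K ?finset.setD11 // => /eqP->;
  rewrite finset.setU0.
Qed.

(** * Integrability and expectation of polynomials in the variable *)

Lemma integrable_lincomb (R : realType) d (T : measurableType d)
    (mu : measure T R) (I : Type) (r : seq I) (Pr : pred I)
    (a : I -> R) (g : I -> T -> R) :
  (forall i, mu.-integrable [set: T] (fun w => (g i w)%:E)) ->
  mu.-integrable [set: T] (fun w => (\sum_(i <- r | Pr i) a i * g i w)%:E).
Proof.
move=> ig; under eq_fun do rewrite -sumEFin.
apply: integrable_sum => // i _.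
by under eq_fun do rewrite EFinM; apply: integrableZl.
Qed.

Lemma expectation_lincomb (R : realType) d (T : measurableType d)
    (P : probability T R) (I : Type) (r : seq I) (Pr : pred I)
    (a : I -> R) (g : I -> T -> R) :
  (forall i, P.-integrable [set: T] (fun w => (g i w)%:E)) ->
  'E_P[fun w => (\sum_(i <- r | Pr i) a i * g i w)%R]%E =
    (\sum_(i <- r | Pr i) a i * fine 'E_P[g i]%E)%:E.
Proof.
move=> ig; rewrite unlock -sumEFin.
under eq_integral do rewrite -sumEFin.
rewrite integral_sum //; last first.
  by move=> i; under eq_fun do rewrite EFinM; apply: integrableZl.
apply: eq_bigr => i _; under eq_integral do rewrite EFinM.
by rewrite integralZl // EFinM fineK //; apply: integrable_fin_num.
Qed.

Lemma integrable_horner (R : realType) d (T : measurableType d)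
    (P : probability T R) (X : {RV P >-> R}) (p : {poly R}) :
  (forall n : nat, (1 <= n)%N ->
     P.-integrable [set: T] (fun w => (X w ^+ n)%:E)) ->
  P.-integrable [set: T] (fun w => (p.[X w])%:E).
Proof.
move=> iX; under eq_fun do rewrite horner_coef.
apply: (integrable_lincomb _ _ _ (g := fun (i : 'I_(size p)) w => X w ^+ i)) => -[].
move=> [|i] lti /=.
  by under eq_fun do rewrite expr0; apply: finite_measure_integrable_cst.
exact: iX.
Qed.

Lemma Q_sequence_horner (R : realType) d (T : measurableType d)
    (P : probability T R) (X : {RV P >-> R}) (Q : nat -> {RV P >-> R}) :
  is_Q_sequence X Q ->
  forall n, exists p : {poly R}, forall w, Q n w = p.[X w].
Proof.
move=> [Q0 QS]; elim/ltn_ind => -[_|n IHn].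
  by exists 1 => w; rewrite Q0 hornerC.
(* Choice asks for a polynomial at every index; 0 is a dummy value beyond n. *)
have /choice[p pE] (i : nat) :
    exists p : {poly R}, (i < n.+1)%N -> forall w, Q i w = p.[X w].
  by case: ltnP => [/IHn[p pE]|_]; [exists p|exists 0].
exists ('X * p n - \sum_(1 <= i < n.+2)
   (fine ('E_P[(fun w' => X w' * Q i.-1 w')%R])%E)%:P * p (n.+1 - i)%N) => w.
rewrite QS // hornerD hornerN hornerM hornerX horner_sum pE //; congr (_ - _).
rewrite big_nat [RHS]big_nat; apply: eq_bigr => i /andP[i_gt0 _].
by rewrite hornerM hornerC pE // ltn_subrL i_gt0.
Qed.

(** * Identification with the free cumulants *)

Theorem proposition1 (R : realType) (d : measure_display)
    (T : measurableType d) (P : probability T R) (Lambda : {RV P >-> R})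
    (kappa : nat -> R) (Q : nat -> {RV P >-> R}) :
  (forall n : nat, (1 <= n)%N ->
     P.-integrable [set: T] (fun w => (Lambda w ^+ n)%:E)) ->
  is_free_cumulants Lambda kappa ->
  is_Q_sequence Lambda Q ->
  forall n : nat, (1 <= n)%N ->
    ('E_P[(fun w => Lambda w * Q n.-1 w)%R])%E = (kappa n)%:E.
Proof.
move=> iL kappaE QE.
pose c n := fine ('E_P[(fun w => Lambda w * Q n.-1 w)%R])%E.
have iQ n : P.-integrable [set: T] (fun w => (Q n w)%:E).
  have [p pE] := Q_sequence_horner QE n.
  by under eq_fun do rewrite pE; apply: integrable_horner.
have iLQ n : P.-integrable [set: T] (fun w => (Lambda w * Q n w)%:E).
  have [p pE] := Q_sequence_horner QE n.
  under eq_fun do rewrite pE -[X in X * _](hornerX) -hornerM.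
  exact: integrable_horner.
case: QE => Q0 QS.
have LQ n w : Lambda w * Q n w =
    Q n.+1 w + \sum_(j < n.+1) c (n.+1 - j)%N * Q j w.
  rewrite (QS n.+1) //= -[X in _ = _ - _ + X](big_mkord xpredT
    (fun j => c (n.+1 - j)%N * Q j w)).
  (* Reversing one sum and shifting the other gives both the general term c_(i+1) Q_(n-i), for i
     from 0 to n. *)
  rewrite [X in _ = _ - _ + X]big_nat_rev [X in _ = _ - X + _]big_add1 /=.
  rewrite [X in _ = _ + X](_ : _ = \sum_(0 <= i < n.+1) c i.+1 * Q (n.+1 - i.+1)%N w).
    by rewrite subrK.
  by apply: eq_big_nat => i /andP[_ ltin]; rewrite add0n subKn.
pose e n := fine ('E_P[Q n])%E.
have e0 : e 0%N = 1.
  rewrite /e unlock; under eq_integral do rewrite Q0.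
  by rewrite integral_cst //= mul1e probability_setT.
have eS n : e n.+1 = 0.
  elim/ltn_ind: n => n IHn.
  have : c n.+1 = e n.+1 + \sum_(j < n.+1) c (n.+1 - j)%N * e j.
    (* The index [None] stands for the leading term [Q n.+1] with coefficient 1, so that the whole
       right-hand side of [LQ] is a single linear combination. *)
    pose g (o : option 'I_n.+1) := if o is Some j then Q j : T -> R else Q n.+1.
    pose a (o : option 'I_n.+1) := if o is Some j then c (n.+1 - j)%N else 1.
    have sumE (u : option 'I_n.+1 -> R) : \sum_o a o * u o =
        u None + \sum_(j < n.+1) c (n.+1 - j)%N * u (Some j).
      rewrite (bigD1 None) //= mul1r; congr (_ + _).
      rewrite (reindex_onto Some (fun o => odflt ord0 o)) => [|[j|]] //=.
      by apply: eq_bigl => j; rewrite eqxx.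
    rewrite /c /= (_ : (fun w => _) = (fun w => \sum_o a o * g o w)).
      by rewrite expectation_lincomb ?sumE // => -[j|]; apply: iQ.
    by apply/funext => w; rewrite sumE LQ.
  (* The term j = 0 is c_(n+1) itself and the others vanish by induction, so e_(n+1) must be 0. *)
  rewrite big_ord_recl e0 mulr1 subn0 big1 => [|[j ltj] _]; last first.
    by rewrite /= /bump add1n IHn ?mulr0.
  by rewrite addr0 -[X in X = _]add0r => /addIr <-.
have cE : forall n, (1 <= n)%N -> c n = kappa n.
  (* The [kappa] side is the k-th moment by hypothesis; the [c] side is obtained by taking
     expectations in the expansion of the k-th power, with N = k. *)
  apply: sum_NC_inj => k k_gt0; apply: EFin_inj; rewrite -kappaE //.
  have -> : (fun w => Lambda w ^+ k) = (fun w =>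
      \sum_(p : {set 'I_k} * {set {set 'I_k}} | open_nc k p.1 p.2)
        (\prod_(B in p.2) c #|B|) * Q #|p.1| w).
    by apply/funext => w; apply: (expr_open_nc (q := Q^~ w)) => // n; apply: LQ.
  rewrite (expectation_lincomb _ _ (fun p : {set 'I_k} * {set {set 'I_k}} =>
    \prod_(B in p.2) c #|B|) (g := fun p => Q #|p.1|)) //; congr EFin; apply: esym.
  rewrite -(pair_big_dep xpredT (fun S pi => open_nc k S pi)
    (fun S pi => (\prod_(B in pi) c #|B|) * e #|S|)) /=.
  (* A nonempty S carries the factor e_|S| = 0; the empty S leaves the sum over [NC k]. *)
  rewrite (bigD1 finset.set0) //= [X in _ + X]big1 ?addr0 => [|S neS0].
    apply: eq_big => [pi|pi _]; first by rewrite open_nc0.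
    by rewrite cards0 e0 mulr1.
  apply: big1 => pi _; case: #|S| (cards_eq0 S) => [|m _]; last by rewrite eS mulr0.
  by rewrite (negbTE neS0).
move=> n n_gt0; rewrite -cE // /c fineK // unlock; exact: integrable_fin_num.
Qed.
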